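(* Trees of maximum degree $3$ have unbounded anagram-free chromatic index; that is, for every positive integer $c$ there exists a tree $T$ with maximum degree $\Delta(T)=3$ such that $\phi'(T) > c$.
   Context: Graphs are finite, simple and undirected. An anagram is a word of the form $W_1W_2$ where $W_1$ is a non-empty word and $W_2$ is a permutation of $W_1$ (i.e. each symbol occurs equally often in $W_1$ and $W_2$). An edge colouring of a graph $G$ is a function from $E(G)$ to a set of colours (no properness is assumed). An edge colouring of $G$ is anagram-free if for every path that is a subgraph of $G$, the sequence of colours of the edges along the path is not an anagram. The anagram-free chromatic index $\phi'(G)$ is the minimum number of colours in an anagram-free edge colouring of $G$. *)

(* Defs.v *)
From mathcomp Require Import all_boot.
From mathcomp Require Import boolp.

Set Implicit Arguments.
Unset Strict Implicit.
Unset Printing Implicit Defensive.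

Definition anagram (A : eqType) (w : seq A) : Prop :=
  exists w1 w2, [/\ w = w1 ++ w2, w1 != [::] & perm_eq w1 w2].

Record sgraph := SGraph {
  vertex :> finType;
  adj : rel vertex;
  adj_sym : symmetric adj;
  adj_irr : irreflexive adj }.

Arguments adj {s} x y.

Section Graphs.
Variable G : sgraph.

Definition edges : {set {set G}} :=
  [set [set x; y] | x in [set: G], y in [set y | adj x y]].

Definition edge := {E : {set G} | E \in edges}.

Definition degree (x : G) : nat := #|[set y | adj x y]|.

Definition max_degree : nat := \max_(x : G) degree x.

Definition connected : Prop := 0 < #|G| /\ forall x y : G, connect adj x y.

(* [ucycle] also accepts the closed walk x, y, x along a single edge, which has
   size 2 and is not a cycle of the graph. *)
Definition acyclic : Prop := forall s : seq G, ucycle adj s -> size s < 3.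

Definition is_tree : Prop := connected /\ acyclic.

Definition is_path (x : G) (p : seq G) : bool := path adj x p && uniq (x :: p).

(* When [path adj x p] holds every pair of consecutive vertices is an edge, so
   the partial projection [insub] discards nothing. *)
Definition path_edges (x : G) (p : seq G) : seq edge :=
  pmap insub (pairmap (fun u v => [set u; v]) x p).

Definition anagram_free (C : eqType) (f : edge -> C) : Prop :=
  forall (x : G) (p : seq G), is_path x p -> ~ anagram (map f (path_edges x p)).

Definition anagram_free_colourable (k : nat) : Prop :=
  exists f : edge -> 'I_k, anagram_free f.

Lemma path_edgesE x p :
  path adj x p ->
  map val (path_edges x p) = pairmap (fun u v => [set u; v]) x p.
Proof.
rewrite /path_edges; elim: p x => //= y p IHp x /andP[xy yp].
have xyE : [set x; y] \in edges.
  by apply/imset2P; exists x y; rewrite ?inE.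
by rewrite insubT /= IHp.
Qed.

Lemma path_edges_uniq x p : uniq (x :: p) -> uniq (path_edges x p).
Proof.
move=> Up; apply: pmap_sub_uniq; elim: p x Up => //= y p IHp x.
case/andP=> xNp Up; rewrite IHp // andbT; apply: contra xNp.
have sub z (q : seq G) E :
    E \in pairmap (fun u v => [set u; v]) z q -> {subset E <= z :: q}.
  elim: q z => //= t q IHq z; rewrite inE => /orP[/eqP-> u|/IHq sE u /sE].
    by rewrite !inE => /orP[]->; rewrite ?orbT.
  by move=> uq; rewrite inE uq orbT.
by move/sub; apply; rewrite !inE eqxx.
Qed.

Lemma uniq_not_anagram (A : eqType) (w : seq A) : uniq w -> ~ anagram w.
Proof.
move=> Uw [[|a w1] [w2 [def_w //= _ w12]]]; move: Uw.
rewrite def_w cat_uniq => /and3P[_ /hasPn disj _].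
have a2 : a \in w2 by rewrite -(perm_mem w12) inE eqxx.
by have := disj a a2; rewrite /= inE eqxx.
Qed.

Lemma anagram_free_colourable_ex :
  exists k, (fun k => `[< anagram_free_colourable k >]) k.
Proof.
exists #|{: edge}|; apply/asboolP; exists enum_rank => x p /andP[_ Up].
apply: uniq_not_anagram; rewrite map_inj_uniq ?path_edges_uniq //.
exact: enum_rank_inj.
Qed.

Definition anagram_free_index : nat := ex_minn anagram_free_colourable_ex.

End Graphs.

(* Main.v *)
Require Import Defs.
From mathcomp Require Import all_boot.
From mathcomp Require Import boolp zify.

Set Implicit Arguments.
Unset Strict Implicit.
Unset Printing Implicit Defensive.

(** The witness is the complete binary tree of height [h].  In a [k]-colouring
    of its edges, give each leaf the vector that counts, for each colour, the
    edges of that colour on the way from the leaf to the root.  The entries are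
    at most [h], so there are at most [(h + 1) ^ k] vectors, but there are
    [2 ^ h] leaves.  If [(h + 1) ^ k < 2 ^ h], two leaves [u] and [v] get the
    same vector ([leaf_collision]).  Above their lowest common ancestor [w] the
    two ways to the root coincide, hence the path from [u] up to [w] and the path
    from [v] up to [w] also agree on the number of edges of each colour.
    Together these two paths form the path from [u] to [v], whose colour
    sequence is then an anagram: its second half is read downwards, but order is
    irrelevant to being a permutation ([meeting_paths_anagram]).  Since an
    exponential beats a power ([exp_beats_power]), no fixed number of colours
    suffices for every height. *)

(** * Paths and their edges *)

Lemma path_edges_cat (G : sgraph) (x : G) p q :
  path_edges x (p ++ q) = path_edges x p ++ path_edges (last x p) q.
Proof. by rewrite /path_edges pairmap_cat pmap_cat. Qed.

Lemma path_edges_rev (G : sgraph) (x : G) p :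
  path_edges (last x p) (rev (belast x p)) = rev (path_edges x p).
Proof.
elim: p x => //= y p IHp x; rewrite rev_cons -cats1 path_edges_cat IHp.
have -> : last (last y p) (rev (belast y p)) = y.
  by case: p {IHp} => //= z p; rewrite rev_cons last_rcons.
rewrite {2}/path_edges /= -/(path_edges y p) /path_edges /= setUC.
by case: insubP => //= [e _ _|_]; rewrite ?rev_cons ?cats1 ?cats0.
Qed.

Lemma size_path_edges (G : sgraph) (x : G) p :
  path adj x p -> size (path_edges x p) = size p.
Proof.
by move=> /path_edgesE E; rewrite -(size_map val) E size_pairmap.
Qed.

(** Reading the second path backwards turns the two into a single path from [x]
    to [y].  The reversal only permutes the colours of the second half, so the
    two halves still have the same colour counts. *)
Lemma meeting_paths_anagram (G : sgraph) (C : eqType) (f : edge G -> C)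
    (x y : G) p q :
  path adj x p -> path adj y q -> last x p = last y q -> p != [::] ->
  uniq (x :: p) -> uniq (y :: q) ->
  {in x :: p & belast y q, forall a b, a != b} ->
  perm_eq (map f (path_edges x p)) (map f (path_edges y q)) ->
  ~ anagram_free f.
Proof.
move=> xp yq lastE p_n0 Up Uq disj perm_pq /(_ x (p ++ rev (belast y q))).
apply.
  apply/andP; split.
    rewrite cat_path xp lastE rev_path (eq_path (e' := adj)) // => a b.
    exact: adj_sym.
  rewrite -cat_cons cat_uniq Up rev_uniq.
  move: Uq; rewrite lastI rcons_uniq => /andP[_ ->]; rewrite andbT.
  apply/hasPn => b; rewrite mem_rev => b_q; apply/negP => b_p.
  by have := disj b b b_p b_q; rewrite eqxx.
exists (map f (path_edges x p)), (rev (map f (path_edges y q))); split.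
- by rewrite path_edges_cat lastE path_edges_rev map_cat map_rev.
- by rewrite -size_eq0 size_map size_path_edges // size_eq0.
- by rewrite perm_sym perm_rev perm_sym.
Qed.

(** * The complete binary tree *)

(** A vertex of depth [n] is the list of the [n] left/right choices that lead to
    it from the root, the last choice first, so that the parent is the tail. *)
Definition parent h (x : h.-bseq bool) : h.-bseq bool :=
  widen_bseq (leq_pred h) [bseq of behead x].

Definition tree_adj h : rel (h.-bseq bool) := fun x y =>
  (0 < size x) && (parent x == y) || (0 < size y) && (parent y == x).

Lemma size_parent h (x : h.-bseq bool) : size (parent x) = (size x).-1.
Proof. by rewrite /= size_behead. Qed.

Lemma tree_adj_sym h : symmetric (@tree_adj h).
Proof. by move=> x y; rewrite /tree_adj orbC. Qed.

Lemma tree_adj_irr h : irreflexive (@tree_adj h).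
Proof.
move=> x; rewrite /tree_adj orbb; apply/negP => /andP[x_gt0 /eqP xE].
by have := size_parent x; rewrite xE; lia.
Qed.

Definition binary_tree h : sgraph :=
  SGraph (@tree_adj_sym h) (@tree_adj_irr h).

Lemma binary_tree_connected h : connected (binary_tree h).
Proof.
have to_root (x : binary_tree h) : connect adj x ([bseq] : h.-bseq bool).
  elim: {x}(size _) {-2}x (erefl (size (x : h.-bseq bool))) => [|n IHn] x sx.
    have -> : x = [bseq] :> h.-bseq bool by apply/val_inj/size0nil.
    exact: connect0.
  apply: connect_trans (IHn (parent x) _); last by rewrite size_parent sx.
  by apply: connect1; rewrite /= /tree_adj sx eqxx.
split=> [|x y]; first by apply/card_gt0P; exists ([bseq] : h.-bseq bool).
apply: connect_trans (to_root x) _.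
by rewrite (sym_connect_sym (@tree_adj_sym h)) to_root.
Qed.

(** At a deepest vertex of a cycle, both neighbours along the cycle have to be
    the parent, so the cycle is a single edge traversed back and forth. *)
Lemma binary_tree_acyclic h : acyclic (binary_tree h).
Proof.
have up (x y : h.-bseq bool) : size y <= size x -> tree_adj x y -> y = parent x.
  move=> le_yx /orP[/andP[_ /eqP]//|/andP[y_gt0 /eqP yE]].
  by move: le_yx; rewrite -yE size_parent; case: (size y) y_gt0 => // n; rewrite ltnn.
case=> // x0 s0 cyc0; rewrite ltnNge; apply/negP => sz0.
pose D (x : binary_tree h) := size (x : h.-bseq bool).
have [x x_s max_x] :
    exists2 x, x \in x0 :: s0 & {in x0 :: s0, forall y, D y <= D x}.
  have [x x_s max_x] := @arg_maxnP _ x0 [in x0 :: s0] D (mem_head _ _).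
  by exists x.
have [i s sE] := rot_to x_s.
have max_s y : y \in x :: s -> D y <= D x by rewrite -sE mem_rot; apply: max_x.
have := cyc0; rewrite -(rot_ucycle i) sE /ucycle /=.
have : 2 < size (x :: s) by rewrite -sE size_rot.
case: s {sE} max_s => // y; case/lastP => // s z max_s _.
rewrite rcons_path /= last_rcons.
case/and3P=> /andP[/andP[xy _] zx] _ /andP[yNs _].
have yE : y = parent x by apply: up xy; apply: max_s; rewrite !inE eqxx orbT.
have zE : z = parent x.
  apply: up; last by rewrite tree_adj_sym.
  by apply: max_s; rewrite !inE mem_rcons mem_head !orbT.
by move: yNs; rewrite yE -zE mem_rcons mem_head.
Qed.

(** Degree 3 is attained at a child of the root, which has its own children as
    soon as the height is at least 2. *)
Lemma binary_tree_max_degree h : max_degree (binary_tree h.+2) = 3.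
Proof.
apply/eqP; rewrite eqn_leq; apply/andP; split.
  apply/bigmax_leqP => x _; rewrite /degree cardE -(size_map val).
  apply: (@uniq_leq_size _ _ [:: behead (val x); true :: val x; false :: val x]).
    by rewrite (map_inj_uniq val_inj) enum_uniq.
  move=> _ /mapP[y + ->]; rewrite mem_enum inE => /orP[] /andP[].
    by move=> _ /eqP <-; rewrite /= mem_head.
  case: y => -[|b y] //= ? _ /eqP/(congr1 val)/= ->.
  by case: b; rewrite !inE eqxx ?orbT.
pose x : binary_tree h.+2 := @Bseq h.+2 bool [:: true] isT.
apply: leq_trans (leq_bigmax x).
pose y0 : binary_tree h.+2 := @Bseq h.+2 bool [::] isT.
pose y1 : binary_tree h.+2 := @Bseq h.+2 bool [:: true; true] isT.
pose y2 : binary_tree h.+2 := @Bseq h.+2 bool [:: false; true] isT.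
have U : uniq [:: y0; y1; y2] by [].
rewrite -[3]/(size [:: y0; y1; y2]) -(card_uniqP U).
apply/subset_leq_card/subsetP => y.
by rewrite !inE => /or3P[] /eqP ->.
Qed.

(** * Colour counts on the way to the root *)

(** The sequence starts at the parent because a path is given by its first
    vertex, here [x], and the list of the remaining ones. *)
Definition climb h (x : h.-bseq bool) n : seq (binary_tree h) :=
  traject (@parent h) (parent x) n.

Lemma size_iter_parent h (x : h.-bseq bool) n :
  size (iter n (@parent h) x) = size x - n.
Proof.
by elim: n => [|n IHn]; rewrite ?subn0 // iterS size_parent IHn subnS.
Qed.

Lemma climb_path h (x : binary_tree h) n :
  n <= size (x : h.-bseq bool) -> path adj x (climb x n).
Proof.
elim: n x => // n IHn x n_lt; rewrite /climb trajectS /=.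
apply/andP; split; first by rewrite /tree_adj (leq_ltn_trans _ n_lt) //= eqxx.
by apply: IHn; rewrite size_parent; case: (size _) n_lt.
Qed.

Lemma iter_parent_inj h (x : h.-bseq bool) (y : h.-bseq bool) i j :
  size x = size y -> i <= size x -> j <= size x ->
  iter i (@parent h) x = iter j (@parent h) y -> i = j.
Proof.
move=> sxy le_i le_j /(congr1 (fun z : h.-bseq bool => size z)).
rewrite !size_iter_parent -sxy => eq_ij.
by rewrite -(subKn le_i) eq_ij subKn.
Qed.

Lemma climb_uniq h (x : binary_tree h) n :
  n <= size (x : h.-bseq bool) -> uniq (x :: climb x n).
Proof.
move=> le_n; rewrite /climb -trajectS.
apply/(uniqP x) => i j; rewrite !inE size_traject => lt_i lt_j.
rewrite !nth_traject //; apply: iter_parent_inj => //.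
  by apply: leq_trans le_n.
by apply: leq_trans le_n.
Qed.

(** Two vertices of equal depth reach their lowest common ancestor after the same
    number [m] of steps, which is the least [m] for which the [m]-th ancestors
    are equal.  From there to the root the two ways coincide, so their colours
    can be cancelled. *)
Lemma equal_counts_not_anagram_free h (C : eqType)
    (f : edge (binary_tree h) -> C) (u v : binary_tree h) n :
  u != v -> size (u : h.-bseq bool) = n -> size (v : h.-bseq bool) = n ->
  perm_eq (map f (path_edges u (climb u n))) (map f (path_edges v (climb v n))) ->
  ~ anagram_free f.
Proof.
move=> neq_uv su sv perm_uv.
have meet_n : iter n (@parent h) u == iter n (@parent h) v.
  have root_n (x : h.-bseq bool) :
      size x = n -> iter n (@parent h) x = [::] :> seq bool.
    by move=> sx; apply: size0nil; rewrite size_iter_parent sx subnn.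
  by rewrite -val_eqE /= !root_n.
have meet : exists m, iter m (@parent h) u == iter m (@parent h) v by exists n.
case: (ex_minnP meet) => m /eqP meet_m min_m.
have le_mn : m <= n by apply: min_m.
have m_gt0 : 0 < m.
  case: m meet_m {min_m le_mn} => // /eqP uv.
  by move: neq_uv; rewrite uv.
have climb_split (x : binary_tree h) : climb x n =
    climb x m ++ climb (iter m (@parent h) x) (n - m).
  by rewrite /climb -{1}(subnKC le_mn) trajectD -iterSr.
have last_climb (x : binary_tree h) : last x (climb x m) = iter m (@parent h) x.
  exact: last_traject.
have mem_climb (x : binary_tree h) z :
    z \in x :: climb x m -> exists2 i, i <= m & z = iter i (@parent h) x.
  by rewrite /climb -trajectS => /trajectP[i lt_i ->]; exists i.
apply: (@meeting_paths_anagram _ _ _ u v (climb u m) (climb v m)).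
- by apply: climb_path; rewrite su.
- by apply: climb_path; rewrite sv.
- by rewrite !last_climb meet_m.
- by rewrite -size_eq0 size_traject -lt0n.
- by apply: climb_uniq; rewrite su.
- by apply: climb_uniq; rewrite sv.
- move=> a b /mem_climb[i le_i ->] b_v.
  have /mem_climb[j le_j bE] : b \in v :: climb v m.
    by rewrite lastI mem_rcons inE b_v orbT.
  (* A common vertex lies at the same height above [u] and [v], and by
     minimality of [m] it is the meeting point, which [belast] leaves out. *)
  apply/eqP => ab.
  have ij : i = j.
    apply: (iter_parent_inj _ _ _ (etrans ab bE)); first by rewrite su sv.
      by rewrite su (leq_trans le_i).
    by rewrite su (leq_trans le_j).
  have jm : j = m.
    apply/eqP; rewrite eqn_leq le_j min_m //.
    by rewrite -bE -ij ab.
  have : uniq (v :: climb v m) by apply: climb_uniq; rewrite sv.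
  have lastE : last v (climb v m) = b by rewrite last_climb bE jm.
  by rewrite lastI rcons_uniq lastE b_v.
- move: perm_uv; rewrite !climb_split !path_edges_cat !last_climb !map_cat.
  by rewrite meet_m perm_cat2r.
Qed.

Definition leaf h (u : h.-tuple bool) : binary_tree h := bseq_of_tuple u.

Lemma leaf_inj h : injective (@leaf h).
Proof. by move=> u v /(congr1 (@bseqval _ _)) uv; apply: val_inj. Qed.

Lemma leaf_collision h k (f : edge (binary_tree h) -> 'I_k) :
  h.+1 ^ k < 2 ^ h -> exists u v : h.-tuple bool,
    u != v /\ perm_eq (map f (path_edges (leaf u) (climb (leaf u) h)))
                      (map f (path_edges (leaf v) (climb (leaf v) h))).
Proof.
move=> lt_h.
pose w u := map f (path_edges (leaf u) (climb (leaf u) h)).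
have sw u : size (w u) = h.
  rewrite size_map size_path_edges ?size_traject //.
  by apply: climb_path; rewrite size_tuple.
pose counts u := [ffun i : 'I_k => inord (count_mem i (w u)) : 'I_h.+1].
have /injectivePn[u [v neq_uv eq_uv]] : ~~ injectiveb counts.
  apply: contraL lt_h => /injectiveP/leq_card.
  by rewrite card_tuple card_bool card_ffun !card_ord -leqNgt.
exists u, v; split=> //; apply/allP => i _; apply/eqP.
have lt_c x : count_mem i (w x) < h.+1 by rewrite ltnS -[leqRHS](sw x) count_size.
by have /ffunP/(_ i) := eq_uv; rewrite !ffunE => /(congr1 val); rewrite /= !inordK.
Qed.

Lemma binary_tree_not_colourable h k :
  h.+1 ^ k < 2 ^ h -> ~ anagram_free_colourable (binary_tree h) k.
Proof.
move=> lt_h [f]; have [u [v [neq_uv perm_uv]]] := leaf_collision f lt_h.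
apply: equal_counts_not_anagram_free perm_uv; try exact: size_tuple.
by rewrite (inj_eq (@leaf_inj h)).
Qed.

(** * The height *)

(** The height is written [h + 2] because a complete binary tree has a vertex of
    degree 3 only from height 2 on.  For [h + 3 = 2 ^ (4 c)] the inequality becomes
    [4 c ^ 2 + 1 < 2 ^ (4 c)], which follows from [2 c + 1 <= 2 ^ (2 c)] by
    squaring. *)
Lemma exp_beats_power c : 0 < c -> exists h, h.+3 ^ c < 2 ^ h.+2.
Proof.
move=> c_gt0.
have large : (4 * c) * c + 1 < 2 ^ (4 * c).
  have -> : 2 ^ (4 * c) = (2 ^ (2 * c)) ^ 2 by rewrite -expnM; congr expn; lia.
  apply: leq_trans (_ : (2 * c).+1 ^ 2 <= _); last by rewrite leq_exp2r // ltn_expl.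
  by rewrite expnS expn1; nia.
have ge3 : 3 <= 2 ^ (4 * c) by apply: leq_trans large; rewrite addn1 !ltnS; nia.
exists (2 ^ (4 * c) - 3); rewrite -[_.+3]addn3 subnK // -expnM ltn_exp2l //.
by move: large ge3; case: (2 ^ _) => [|[|[|n]]] //; lia.
Qed.

Theorem theorem2 : forall c : nat, 0 < c ->
  exists T : sgraph,
    [/\ is_tree T, max_degree T = 3 & c < anagram_free_index T].
Proof.
move=> c c_gt0; have [h lt_h] := exp_beats_power c_gt0.
exists (binary_tree h.+2); split; first split.
- exact: binary_tree_connected.
- exact: binary_tree_acyclic.
- exact: binary_tree_max_degree.
rewrite /anagram_free_index; case: ex_minnP => k /asboolP col _.
rewrite ltnNge; apply/negP => le_kc.
apply: (binary_tree_not_colourable _ col).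
by apply: leq_ltn_trans lt_h; rewrite leq_pexp2l.
Qed.
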